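(* Let $C_3>0$ be any constant, and let $\{\pi^k\}_{k\ge0}$ be generated by projected policy gradient (PPG) with step sizes satisfying, for all $k\ge 0$, $$\eta_k\ge\frac{2+5|\mathcal{A}|}{\tilde\mu}\cdot\frac{1-\gamma}{C_3}\left(1+\frac{1-\gamma}{C_3}\right)^{k+1}.$$ Then for all $k\ge0$, $$V^*(\rho)-V^k(\rho)\le\frac{1}{1-\gamma}\left(1-(1-\gamma)\left\|\frac{d_\rho^*}{\rho}\right\|_\infty^{-1}\frac{1-\gamma}{1-\gamma+C_3}\right)^k.$$
   Context: MDP: a tuple $(\mathcal{S},\mathcal{A},P,r,\gamma)$ with finite state space $\mathcal{S}$, finite action space $\mathcal{A}$, transition probabilities $P(s'|s,a)$, reward $r:\mathcal{S}\times\mathcal{A}\to[0,1]$ and discount factor $\gamma\in[0,1)$. $\Delta(\mathcal{A})$, $\Delta(\mathcal{S})$ denote probability simplices; a policy is $\pi=(\pi(\cdot|s))_{s\in\mathcal{S}}$ with $\pi(\cdot|s)\in\Delta(\mathcal{A})$; $\pi_s$ denotes $\pi(\cdot|s)$. Values: $V^\pi(s)=\mathbb{E}[\sum_{t\ge0}\gamma^t r(s_t,a_t)\mid s_0=s,\pi]$, $Q^\pi(s,a)=\mathbb{E}[\sum_{t\ge0}\gamma^t r(s_t,a_t)\mid s_0=s,a_0=a,\pi]$, and $V^\pi(\rho)=\mathbb{E}_{s\sim\rho}[V^\pi(s)]$. $V^*$ is the optimal state value, and an optimal policy is a policy whose state value is $V^*$. Visitation measure: $d_\rho^\pi(s)=(1-\gamma)\mathbb{E}[\sum_{t\ge0}\gamma^t\mathbf{1}\{s_t=s\}\mid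 s_0\sim\rho,\pi]$; $d_\rho^*=d_\rho^{\pi^*}$ for a fixed optimal policy $\pi^*$. For policies $\pi^k$, write $V^k,Q^k,d_\mu^k$ for $V^{\pi^k},Q^{\pi^k},d_\mu^{\pi^k}$. Ratios of vectors are entrywise, $\|\cdot\|_\infty$ is the maximum absolute entry. Distributions: $\mu\in\Delta(\mathcal{S})$ is fixed with $\tilde\mu=\min_s\mu(s)>0$; $\rho\in\Delta(\mathcal{S})$ is arbitrary with $\min_s\rho(s)>0$. PPG update, from an arbitrary initial policy $\pi^0$: for every $s$, $\pi_s^{k+1}=\mathrm{Proj}_{\Delta(\mathcal{A})}\left(\pi_s^k+\eta_s^kQ^k(s,\cdot)\right)$ with $\eta_s^k=\frac{\eta_k}{1-\gamma}d_\mu^k(s)$, where $\mathrm{Proj}_{\Delta(\mathcal{A})}$ is the Euclidean projection onto the simplex. *)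

(* Defs.v *)
From HB Require Import structures.
From mathcomp Require Import all_boot all_order all_algebra.
From mathcomp Require Import all_classical all_reals all_analysis.
Set Implicit Arguments.
Unset Strict Implicit.
Unset Printing Implicit Defensive.
Import Order.TTheory GRing.Theory Num.Theory.
Import numFieldNormedType.Exports.
Local Open Scope classical_set_scope.
Local Open Scope ring_scope.

Record dist (R : realType) (T : finType) := Dist {
  dist_fun :> T -> R;
  dist_ge0 : forall t, 0 <= dist_fun t;
  dist_sum1 : \sum_t dist_fun t = 1 }.

Section Dist.
Variable R : realType.

Lemma dirac_ge0 (T : finType) (x y : T) : 0 <= (y == x)%:R :> R.
Proof. exact: ler0n. Qed.

Lemma dirac_sum1 (T : finType) (x : T) : \sum_y (y == x)%:R = 1 :> R.
Proof.
by rewrite (bigD1 x)//= eqxx big1 ?addr0// => y /negPf ->.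
Qed.

Definition dist_dirac (T : finType) (x : T) : dist R T :=
  Dist (dirac_ge0 x) (dirac_sum1 x).

Lemma pair_ge0 (T U : finType) (p : dist R T) (k : T -> dist R U) (z : (T * U)%type) :
  0 <= p z.1 * k z.1 z.2.
Proof. by rewrite mulr_ge0 ?dist_ge0. Qed.

Lemma pair_sum1 (T U : finType) (p : dist R T) (k : T -> dist R U) :
  \sum_(z : (T * U)%type) p z.1 * k z.1 z.2 = 1.
Proof.
rewrite -(pair_big xpredT xpredT (fun t u => p t * k t u))/=.
rewrite -[RHS](dist_sum1 p); apply: eq_bigr => t _.
by rewrite -mulr_sumr dist_sum1 mulr1.
Qed.

(* law of (t, u) when t ~ p and u ~ k t *)
Definition dist_pair (T U : finType) (p : dist R T) (k : T -> dist R U) :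
  dist R (T * U)%type := Dist (pair_ge0 p k) (pair_sum1 p k).

End Dist.

Definition markov_chain (R : realType) (T : finType) (d : measure_display)
    (Omega : measurableType d) (Pr : probability Omega R)
    (nu : dist R T) (K : T -> dist R T) (X : nat -> Omega -> T) : Prop :=
  (forall t x, measurable [set w | X t w = x]) /\
  (forall n (x : nat -> T),
     Pr [set w | forall i, (i <= n)%N -> X i w = x i] =
     (nu (x 0%N) * \prod_(i < n) K (x i) (x i.+1))%:E).

(* The sample space is R with the uniform law on [0, 1]. *)
Definition unif (R : realType) : probability (measurableTypeR R) R :=
  uniform_prob (@ltr01 R).

Section ChainExistence.
Variables (R : realType) (T : finType) (x0 : T) (K : T -> dist R T).
Implicit Types (p : dist R T) (u : R) (x : T).

Let cum p x : R := \sum_(y | (enum_rank y < enum_rank x)%N) p y.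

Let cell p u x := (cum p x <= u) && (u < cum p x + p x).

Let quantile p u : T := odflt x0 [pick x | cell p u x].

(* Inverse-CDF sampling of X 0, then of X 1 from the rescaled remainder of u,
   and so on. *)
Fixpoint chain_path p u (n : nat) : T :=
  let x := quantile p u in
  if n is m.+1 then chain_path (K x) ((u - cum p x) / p x) m else x.

Let cum_ge0 p x : 0 <= cum p x.
Proof. by apply: sumr_ge0 => y _; exact: dist_ge0. Qed.

Let cumS p x y : (enum_rank x < enum_rank y)%N -> cum p x + p x <= cum p y.
Proof.
move=> xy; rewrite /cum [leRHS](bigD1 x)//= addrC lerD2r.
rewrite [leRHS](bigID (fun z => (enum_rank z < enum_rank x)%N))/=.
rewrite -[leLHS]addr0 lerD//; last by apply: sumr_ge0 => z _; exact: dist_ge0.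
rewrite le_eqVlt; apply/orP; left; apply/eqP/eq_bigl => z.
have [zx|] := boolP (enum_rank z < enum_rank x)%N; last by rewrite andbF.
rewrite andbT (ltn_trans zx xy)/=; apply/esym/negP => /eqP zE.
by rewrite zE ltnn in zx.
Qed.

Let cum_le1 p x : cum p x + p x <= 1.
Proof.
rewrite -(dist_sum1 p) [leRHS](bigD1 x)//= addrC lerD2r /cum.
rewrite [leRHS](bigID (fun z => (enum_rank z < enum_rank x)%N))/=.
rewrite -[leLHS]addr0 lerD//; last by apply: sumr_ge0 => z _; exact: dist_ge0.
rewrite le_eqVlt; apply/orP; left; apply/eqP/eq_bigl => z.
have [zx|] := boolP (enum_rank z < enum_rank x)%N; last by rewrite andbF.
by rewrite andbT; apply/esym/negP => /eqP zE; rewrite zE ltnn in zx.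
Qed.

Let cell_inj p u x y : cell p u x -> cell p u y -> x = y.
Proof.
move=> /andP[x1 x2] /andP[y1 y2].
have [xy|yx|/val_inj/enum_rank_inj//] := ltngtP (enum_rank x) (enum_rank y).
- have := le_lt_trans (le_trans (cumS p xy) y1) x2; by rewrite ltxx.
- have := le_lt_trans (le_trans (cumS p yx) x1) y2; by rewrite ltxx.
Qed.

Let cell_ex p u : 0 <= u < 1 -> exists x, cell p u x.
Proof.
move=> /andP[u0 u1].
pose P x := cum p x <= u.
have [x|] := pickP P; last first.
  move=> P0; exfalso.
  have : (0 < #|T|)%N by apply/card_gt0P; exists x0.
  move=> T0; have := P0 (enum_val (Ordinal T0)).
  by rewrite /P /cum big_pred0 ?u0// => y; rewrite enum_valK.
move=> Px.
case: (@arg_maxnP _ x P (fun x => enum_rank x) Px) => y Py ymax.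
exists y; apply/andP; split => //; rewrite ltNge; apply/negP => yu.
have [yT|yT] := ltnP (enum_rank y).+1 #|T|.
  have := ymax (enum_val (Ordinal yT)); rewrite enum_valK/= ltnn.
  suff -> : P (enum_val (Ordinal yT)) by move=> /(_ isT).
  rewrite /P; apply: le_trans yu; rewrite /cum (bigD1 y)/=; last first.
    by rewrite enum_valK.
  rewrite addrC lerD2r le_eqVlt; apply/orP; left; apply/eqP/eq_bigl => z.
  rewrite enum_valK/= ltnS leq_eqVlt.
  have [->|zy] := eqVneq z y; first by rewrite ltnn andbF.
  rewrite andbT; have [/val_inj/enum_rank_inj zE|//] := eqVneq (val (enum_rank z)) (enum_rank y).
  by rewrite zE eqxx in zy.
have : u < u.
  apply: lt_le_trans u1 _; apply: le_trans yu.
  rewrite -(dist_sum1 p) [leLHS](bigD1 y)//= addrC lerD2r le_eqVlt.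
  apply/orP; left; apply/eqP/eq_bigl => z.
  have zT : (enum_rank z <= enum_rank y)%N by rewrite -ltnS (leq_trans _ yT).
  apply/esym; rewrite ltn_neqAle zT andbT; congr (~~ _).
  by apply/eqP/eqP => [/val_inj/enum_rank_inj|->].
by rewrite ltxx.
Qed.

Let quantileP p u x : 0 <= u < 1 -> (quantile p u = x <-> cell p u x).
Proof.
move=> u01; rewrite /quantile; case: pickP => [y py|] /=; last first.
  by have [y py] := cell_ex p u01 => /(_ y); rewrite py.
by split=> [<-//|]; exact: cell_inj py.
Qed.

(* Each cylinder is an interval whose length is its probability. *)
Let cylinder_itv n p (x : nat -> T) :
  let w := p (x 0%N) * \prod_(i < n) K (x i) (x i.+1) in
  exists l : R, [/\ 0 <= l, l + w <= 1 & forall u,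
    (0 <= u < 1 /\ (forall i, (i <= n)%N -> chain_path p u i = x i))
    <-> l <= u < l + w].
Proof.
elim: n p x => [|n IH] p x w.
  exists (cum p (x 0%N)); rewrite {}/w big_ord0 mulr1; split=> //.
  move=> u; split.
    by move=> [u01 /(_ 0%N isT)/= /(quantileP _ _ u01)].
  move=> /andP[u0 u1]; have u01 : 0 <= u < 1.
    by rewrite (le_trans (cum_ge0 _ _) u0) (lt_le_trans u1).
  split=> // i; rewrite leqn0 => /eqP -> /=; apply/quantileP => //.
  exact/andP.
have [l [l0 l1 lP]] := IH (K (x 0%N)) (fun i => x i.+1).
set w' := (_ * _) in l1 lP.
have wE : w = p (x 0%N) * w' by rewrite /w big_ord_recl.
have w'0 : 0 <= w'.
  by rewrite mulr_ge0 ?dist_ge0// prodr_ge0// => i _; exact: dist_ge0.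
have [px0|px0] := eqVneq (p (x 0%N)) 0.
  exists 0; rewrite wE px0 mul0r addr0; split => // u; split.
    move=> [u01 /(_ 0%N isT)/= /(quantileP _ _ u01)].
    by rewrite /cell px0 addr0 => /andP[/le_lt_trans h /h]; rewrite ltxx.
  by move=> /andP[/le_lt_trans h /h]; rewrite ltxx.
have px : 0 < p (x 0%N) by rewrite lt_neqAle eq_sym px0 dist_ge0.
exists (cum p (x 0%N) + p (x 0%N) * l); rewrite wE; split.
- by rewrite addr_ge0// mulr_ge0// ltW.
- rewrite -addrA -mulrDr (le_trans _ (cum_le1 p (x 0%N)))// lerD2l.
  by rewrite -[leRHS]mulr1 ler_pM2l.
move=> u.
have itvE : (cum p (x 0%N) + p (x 0%N) * l <= u
    < cum p (x 0%N) + p (x 0%N) * l + p (x 0%N) * w') =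
    (l <= (u - cum p (x 0%N)) / p (x 0%N) < l + w').
  rewrite ler_pdivlMr// ltr_pdivrMr// -addrA -mulrDr.
  by rewrite lerBrDl ltrBlDl ![_ * p _]mulrC.
rewrite itvE; split.
  move=> [u01 h]; apply/lP.
  have xE : quantile p u = x 0%N by exact: (h 0%N isT).
  have /andP[c1 c2] := (quantileP p (x 0%N) u01).1 xE.
  split.
    rewrite divr_ge0 ?subr_ge0 ?(ltW px)//= ltr_pdivrMr// mul1r.
    by rewrite ltrBlDl.
  by move=> i ilen; have /= := h i.+1 ilen; rewrite xE.
move=> /lP[/andP[v0 v1] h].
have c : cell p u (x 0%N).
  move: v0 v1; rewrite ler_pdivlMr// mul0r subr_ge0 ltr_pdivrMr// mul1r.
  by rewrite ltrBlDl /cell => -> ->.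
have u01 : 0 <= u < 1.
  move/andP : c => [c1 c2].
  by rewrite (le_trans (cum_ge0 _ _) c1) (lt_le_trans c2).
split=> // -[_/=|i ilen]; first exact/quantileP.
by have /= := h i ilen; rewrite ((quantileP p (x 0%N) u01).2 c).
Qed.

Let unif_itv (l w : R) : 0 <= l -> 0 <= w -> l + w <= 1 ->
  unif R `[l, (l + w)%R[%classic = w%:E.
Proof.
move=> l0 w0 lw1; rewrite /unif /= /uniform_prob.
rewrite (eq_integral (fun=> 1%:E)); last first.
  move=> u; rewrite inE/= in_itv/= /uniform_pdf => /andP[lu ulw].
  by rewrite (le_trans l0 lu) (le_trans (ltW ulw) lw1)/= subr0 invr1.
rewrite integral_cst//= mul1e lebesgue_measure_itv/= lte_fin ltrDl.
case: ltP => [_|w_le0]; first by rewrite -EFinD addrAC subrr add0r.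
by congr _%:E; apply/eqP; rewrite eq_le w0 w_le0.
Qed.

Let unif_null (A : set R) : measurable (A : set (measurableTypeR R)) ->
  A `<=` ~` `[0, 1[%classic -> unif R A = 0%E.
Proof.
move=> mA A01; apply/eqP; rewrite eq_le measure_ge0 andbT.
have m01 : measurable (`[0%R, 1%R[%classic : set (measurableTypeR R)).
  exact: measurable_itv.
have := probability_setC (unif R) m01.
have -> : unif R `[0%R, 1%R[%classic = 1%E.
  by rewrite -[X in `[_, X[]add0r unif_itv// add0r.
rewrite subee// => <-; apply: le_measure; rewrite ?inE//.
exact: measurableC.
Qed.

Let chain p (t : nat) (u : R) : T :=
  if 0 <= u < 1 then chain_path p u t else x0.

Let cylinder_measurable p n (x : nat -> T) :
  measurable ([set u | forall i, (i <= n)%N -> chain p i u = x i] :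
    set (measurableTypeR R)).
Proof.
have [l [l0 l1 lP]] := cylinder_itv n p x.
set w := (_ * _) in l1 lP.
pose c := forall i, (i <= n)%N -> x0 = x i.
have -> : [set u | forall i, (i <= n)%N -> chain p i u = x i] =
    `[l, (l + w)%R[%classic `|` (if `[< c >] then ~` `[0%R, 1%R[%classic else set0).
  apply/seteqP; split=> u /=.
    rewrite /chain; have [u01|u01] := boolP (0 <= u < 1) => h.
      by left; rewrite in_itv/=; apply/lP.
    right; case: asboolP => [_|]; last by apply.
    by rewrite /= in_itv/=; exact/negP.
  move=> [|].
    by rewrite in_itv/= => /lP[u01 h] i ilen; rewrite /chain u01 h.
  case: asboolP => //= cx; rewrite in_itv/= => /negP/negPf u01 i ilen.
  by rewrite /chain u01; exact: cx.
apply: measurableU; first exact: measurable_itv.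
case: ifP => // _; apply: measurableC; exact: measurable_itv.
Qed.

Let cylinder_prob p n (x : nat -> T) :
  unif R [set u | forall i, (i <= n)%N -> chain p i u = x i] =
  (p (x 0%N) * \prod_(i < n) K (x i) (x i.+1))%:E.
Proof.
have [l [l0 l1 lP]] := cylinder_itv n p x.
have mC := cylinder_measurable p n x.
set C := [set u | _] in mC *; set w := (_ * _) in l1 lP *.
have w0 : 0 <= w.
  by rewrite mulr_ge0 ?dist_ge0// prodr_ge0// => i _; exact: dist_ge0.
have m01 : measurable (`[0%R, 1%R[%classic : set (measurableTypeR R)).
  exact: measurable_itv.
rewrite -(setUIDK C `[0%R, 1%R[%classic) measureU/=; last 3 first.
- exact: measurableI.
- exact: measurableD.
- by rewrite setDE setIACA setICr setI0.
rewrite [X in (_ + X)%E]unif_null ?adde0; last 2 first.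
- exact: measurableD.
- by move=> u [].
rewrite -[RHS](unif_itv l0 w0 l1); congr (unif R _).
apply/seteqP; split=> u /=.
  rewrite !in_itv/= => -[h u01]; apply/lP; split=> // i ilen.
  by have := h i ilen; rewrite /chain u01.
rewrite !in_itv/= => /lP[u01 h]; split=> // i ilen.
by rewrite /chain u01 h.
Qed.

Lemma markov_chain_exists_aux p : exists X, markov_chain (unif R) p K X.
Proof.
exists (chain p); split; last by move=> n x; exact: cylinder_prob.
move=> t x.
have -> : [set u | chain p t u = x] =
    \bigcup_(f in [set f : {ffun 'I_t.+1 -> T} | f ord_max = x])
      [set u | forall i, (i <= t)%N -> chain p i u = f (inord i)].
  apply/seteqP; split=> u /=.
    move=> ux; exists [ffun i : 'I_t.+1 => chain p i u] => /=.
      by rewrite ffunE.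
    by move=> i it; rewrite ffunE inordK.
  move=> [f /= fx /(_ t (leqnn t)) ->].
  by rewrite -fx; congr (f _); apply/val_inj; rewrite /= inordK.
apply: fin_bigcup_measurable => // f _; exact: cylinder_measurable.
Qed.

End ChainExistence.

Lemma markov_chain_exists (R : realType) (T : finType) (nu : dist R T)
  (K : T -> dist R T) : exists X, markov_chain (unif R) nu K X.
Proof.
have [x0 _|T0] := pickP (@predT T); first exact: markov_chain_exists_aux.
by have /eqP := dist_sum1 nu; rewrite big_pred0// eq_sym oner_eq0.
Qed.

Section Chain.
Variables (R : realType) (T : finType) (nu : dist R T) (K : T -> dist R T).

(* The choice of the chain is immaterial: all laws are fixed by [chainP]. *)
Definition chain : nat -> measurableTypeR R -> T :=
  projT1 (cid (markov_chain_exists nu K)).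

Lemma chainP : markov_chain (unif R) nu K chain.
Proof. exact: projT2 (cid (markov_chain_exists nu K)). Qed.

(* Used with 0 <= f <= 1 only, so that the integral is finite. *)
Definition expected_discounted_sum (g : R) (f : T -> R) : R :=
  fine (\int[unif R]_w (\sum_(0 <= t <oo) (g ^+ t * f (chain t w))%:E))%E.

End Chain.

Record mdp (R : realType) (S A : finType) := MDP {
  transition : S -> A -> dist R S;
  reward : S -> A -> R;
  reward_itv : forall s a, 0 <= reward s a <= 1;
  discount : R;
  discount_itv : 0 <= discount < 1 }.

Definition policy (R : realType) (S A : finType) := S -> dist R A.

Definition min_entry (R : realType) (T : finType) (p : dist R T) : R :=
  \big[Num.min/1]_t p t. (* 1 is neutral: the entries are at most 1 *)

Definition linf_norm (R : realType) (T : finType) (v : T -> R) : R :=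
  \big[Num.max/0]_t `|v t|.

Definition l2_norm (R : realType) (T : finType) (v : T -> R) : R :=
  Num.sqrt (\sum_t v t ^+ 2).

(* p is the Euclidean projection of v onto the simplex of distributions *)
Definition is_simplex_proj (R : realType) (T : finType) (v : T -> R)
    (p : dist R T) : Prop :=
  forall q : dist R T,
    l2_norm (fun t => p t - v t) <= l2_norm (fun t => q t - v t).

Section MDP.
Variables (R : realType) (S A : finType) (M : mdp R S A).
Implicit Types (pi : policy R S A) (rho mu : dist R S).

Local Notation gamma := (discount M).

(* kernel of the chain (s_t, a_t) *)
Definition state_action_kernel pi (z : S * A) : dist R (S * A)%type :=
  dist_pair (transition M z.1 z.2) pi.

Definition Vfun pi (s : S) : R :=
  expected_discounted_sum (dist_pair (dist_dirac R s) pi)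
    (state_action_kernel pi) gamma (fun z => reward M z.1 z.2).

Definition Qfun pi (s : S) (a : A) : R :=
  expected_discounted_sum (dist_dirac R (s, a))
    (state_action_kernel pi) gamma (fun z => reward M z.1 z.2).

Definition mean_value (V : S -> R) rho : R := \sum_s rho s * V s.

Definition Vopt (s : S) : R :=
  sup [set v | exists pi : policy R S A, v = Vfun pi s].

Definition is_optimal pi : Prop := forall s, Vfun pi s = Vopt s.

Definition visitation pi rho (s : S) : R :=
  (1 - gamma) *
  expected_discounted_sum (dist_pair rho pi)
    (state_action_kernel pi) gamma (fun z => (z.1 == s)%:R).

Definition is_ppg mu (eta : nat -> R) (pi : nat -> policy R S A) : Prop :=
  forall k s,
    let eta_s := eta k / (1 - gamma) * visitation (pi k) mu s in
    is_simplex_proj (fun a => pi k s a + eta_s * Qfun (pi k) s a)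
      (pi k.+1 s).

End MDP.

(* Main.v *)
Require Import Defs.
From mathcomp Require Import all_boot all_order all_algebra.
From mathcomp Require Import all_classical all_reals all_analysis.
From mathcomp Require Import measurable_realfun ring lra.
Import Order.TTheory GRing.Theory Num.Theory.
Import numFieldNormedType.Exports.
Set Implicit Arguments.
Unset Strict Implicit.
Unset Printing Implicit Defensive.
Local Open Scope ring_scope.

(* Let p' be the projection of p + eta Q, and let G(q) = <q - p, Q>.  The
   variational inequality at q, combined with |p' - p|^2 <= eta G(p') and
   Young's inequality, gives for every kappa in [0, 1]
     G(p') >= (2 kappa - kappa^2) G(q) - 7 kappa^2 / eta,
   which is affine in G(q).  Averaging it at q = pi_opt with respect to the
   visitation measure of pi_opt, and using the performance difference identity
   together with d_rho >= (1 - gamma) rho, gives a linear recursion for the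
   optimality gap x_k = (1 - gamma) (V^*(rho) - V^k(rho)):
     x_{k+1} <= x_k - b ((2 kappa - kappa^2) x_k - kappa^2 eps_k),
   with b = (1 - gamma) / |d_rho^* / rho|_oo.  For
   kappa = (1 - gamma) / (1 - gamma + C3) the step sizes make
   kappa eps_k <= (1 - kappa)^(k+2), so x_k <= (1 - b kappa)^k propagates,
   because 1 - kappa <= 1 - b kappa. *)

(** * Expectations along a finite Markov chain *)

Lemma measure_fin_partition (R : realType) (d : measure_display)
    (Omega : measurableType d) (P : {measure set Omega -> \bar R}) (T : finType)
    (Y : Omega -> T) (B : set Omega) :
  (forall y, measurable (B `&` [set w | Y w = y])%classic) ->
  P B = (\sum_y P (B `&` [set w | Y w = y])%classic)%E.
Proof.
move=> mBY.
have -> : (\sum_y P (B `&` [set w | Y w = y])%classic)%E =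
    (\sum_(y \in [set: T]) P (B `&` [set w | Y w = y])%classic)%E.
  rewrite (fsbigE (enum T)) ?enum_uniq//; last by move=> y; rewrite mem_enum.
  by rewrite (eq_bigl xpredT) ?big_enum// => y; rewrite in_setT.
rewrite -measure_fin_bigcup//; last 2 first.
- exact: finite_finset.
- by move=> y z _ _ [w [[_ /= <-] [_ /= <-]]].
congr (P _); apply/seteqP; split=> w /=; first by move=> Bw; exists (Y w).
by move=> [y _ []].
Qed.

Lemma measurable_fun_fin_valued (d d' : measure_display)
    (Omega : measurableType d) (U : measurableType d') (T : finType)
    (X : Omega -> T) (h : T -> U) :
  (forall x, measurable [set w | X w = x]%classic) ->
  measurable_fun [set: Omega]%classic (fun w => h (X w)).
Proof.
move=> mX _ B _; rewrite setTI.
have -> : ((fun w => h (X w)) @^-1` B)%classic =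
    (\bigcup_(x in [set x | B (h x)]) [set w | X w = x])%classic.
  by apply/seteqP; split=> w /=; [move=> Bw; exists (X w) | move=> [x /= + ->]].
by apply: fin_bigcup_measurable => // x _; exact: mX.
Qed.

Lemma integral_fin_valued (R : realType) (d : measure_display)
    (Omega : measurableType d) (P : {measure set Omega -> \bar R}) (T : finType)
    (X : Omega -> T) (h : T -> R) :
  (forall x, measurable [set w | X w = x]%classic) -> (forall x, 0 <= h x) ->
  (\int[P]_w (h (X w))%:E = \sum_x (h x)%:E * P [set w | X w = x]%classic)%E.
Proof.
move=> mX h0.
transitivity (\int[P]_w (\sum_(x <- enum T)
    ((h x)%:E * (\1_[set w | X w = x]%classic w)%:E)))%E.
  apply: eq_integral => w _; rewrite big_enum/= (bigD1 (X w))//= big1.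
    by rewrite indicE mem_set//= mule1 adde0.
  move=> x xw; rewrite indicE memNset ?mule0//= => /esym /eqP.
  by rewrite (negPf xw).
rewrite ge0_integral_sum//; last 2 first.
- move=> x; apply: measurable_funeM; apply/measurable_EFinP.
  exact: measurable_indic.
- by move=> x w _; rewrite -EFinM lee_fin mulr_ge0// indicE ler0n.
rewrite big_enum/=; apply: eq_bigr => x _.
rewrite ge0_integralZl_EFin//; last by apply/measurable_EFinP; exact: measurable_indic.
by rewrite integral_indic// setIT.
Qed.

(** Only cylinder probabilities are given, so the law of [X n] comes from summing over the whole
    path [Y n]. The induction generalizes [h]: one step back in time replaces [h] by its mean under
    [K]. *)
Lemma markov_chain_fun (R : realType) (T : finType) (d : measure_display)
    (Omega : measurableType d) (Pr : probability Omega R)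
    (nu : dist R T) (K : T -> dist R T) (X : nat -> Omega -> T) (h : T -> R) n :
  markov_chain Pr nu K X -> (forall x, 0 <= h x) ->
  (\int[Pr]_w (h (X n w))%:E =
   (\sum_x nu x * iter n (fun u x => \sum_y K x y * u y)%R h x)%:E)%E.
Proof.
move=> [mX PX].
pose Y n w : {ffun 'I_n.+1 -> T} := [ffun i : 'I_n.+1 => X i w].
pose wt n (f : {ffun 'I_n.+1 -> T}) : R :=
  nu (f ord0) * \prod_(i < n) K (f (inord i)) (f (inord i.+1)).
have PY m f : Pr [set w | Y m w = f]%classic = (wt m f)%:E.
  have := PX m (fun i => f (inord i)).
  have -> : inord 0 = ord0 :> 'I_m.+1 by apply/val_inj; rewrite /= inordK.
  move=> <-; congr (Pr _); apply/seteqP; split=> w /=.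
    by move=> <- i im; rewrite ffunE inordK.
  by move=> Xf; apply/ffunP => i; rewrite ffunE Xf ?inord_val// -ltnS.
have mY m f : measurable [set w | Y m w = f]%classic.
  have -> : [set w | Y m w = f]%classic =
      (\bigcap_(i in [set: 'I_m.+1]) [set w | X i w = f i])%classic.
    apply/seteqP; split=> w /=; first by move=> <- i _ /=; rewrite ffunE.
    by move=> Xf; apply/ffunP => i; rewrite ffunE; exact: Xf.
  by apply: fin_bigcap_measurable => // i _; exact: mX.
(* The event is split by the path up to time m; each piece is a cylinder whose weight gains the
   factor [K (f ord_max) y]. *)
have PXS m y : Pr [set w | X m.+1 w = y]%classic =
    (\sum_f wt m f * K (f ord_max) y)%:E.
  rewrite (@measure_fin_partition _ _ _ _ _ (Y m)); last first.
    by move=> f; apply: measurableI; [exact: mX | exact: mY].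
  rewrite -sumEFin; apply: eq_bigr => f _.
  pose x i := if (i <= m)%N then f (inord i) else y.
  have x0 : x 0%N = f ord0.
    by rewrite /x; congr (f _); apply/val_inj; rewrite /= inordK.
  have -> : wt m f * K (f ord_max) y =
      nu (x 0%N) * \prod_(i < m.+1) K (x i) (x i.+1).
    rewrite big_ord_recr /= x0 mulrA /wt; congr (_ * _ * K _ _).
    - apply: eq_bigr => i _; rewrite /x ltnW ?ltn_ord//.
    - by rewrite /x leqnn; congr (f _); apply/val_inj; rewrite /= inordK.
    - by rewrite /x ltnn.
  rewrite -PX; congr (Pr _); apply/seteqP; split=> w /=.
    move=> [Xy Yf] i; rewrite leq_eqVlt ltnS => /predU1P[->|im].
      by rewrite /x ltnn.
    by rewrite /x im -Yf ffunE inordK.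
  move=> Xx; split; first by rewrite Xx// /x ltnn.
  apply/ffunP => i; rewrite ffunE Xx; last by rewrite leqW// -ltnS.
  by rewrite /x inord_val -ltnS ltn_ord.
have intY m g : (forall x, 0 <= g x) ->
    (\int[Pr]_w (g (X m w))%:E = (\sum_f wt m f * g (f ord_max))%:E)%E.
  move=> g0; transitivity (\int[Pr]_w (g (Y m w ord_max))%:E)%E.
    by apply: eq_integral => w _; rewrite ffunE.
  rewrite (@integral_fin_valued _ _ _ Pr _ (Y m)
    (fun f : {ffun 'I_m.+1 -> T} => g (f ord_max)))//; last exact: mY.
  by rewrite -sumEFin; apply: eq_bigr => f _; rewrite [X in (_ * X)%E]PY -EFinM mulrC.
elim: n h => [|n IH] h h0.
  rewrite integral_fin_valued// -sumEFin; apply: eq_bigr => x _ /=.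
  have := PX 0%N (fun=> x); rewrite big_ord0 mulr1 => PX0.
  rewrite EFinM muleC -PX0; congr (Pr _ * _)%E.
  apply/seteqP; split=> w /=; last exact.
  by move=> <- i; rewrite leqn0 => /eqP ->.
(* The innermost mean is absorbed into the function, so that both sides become sums over paths up to
   time n. *)
rewrite iterSr -IH; last first.
  by move=> x; apply: sumr_ge0 => y _; rewrite mulr_ge0 ?dist_ge0.
rewrite [RHS](intY n (fun x => \sum_y K x y * h y)); last first.
  by move=> x; apply: sumr_ge0 => y _; rewrite mulr_ge0 ?dist_ge0.
rewrite integral_fin_valued//.
under eq_bigr => y _ do rewrite [X in (_ * X)%E]PXS -EFinM.
rewrite sumEFin; congr _%:E.
under eq_bigr => y _ do rewrite mulr_sumr.
rewrite exchange_big/=; apply: eq_bigr => f _; rewrite mulr_sumr.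
by apply: eq_bigr => y _; rewrite mulrCA [h y * _]mulrC.
Qed.

(** * The discounted equation W = f + g K W *)

Section Resolvent.
Variables (R : realType) (T : finType) (K : T -> dist R T) (g : R).
Hypothesis g01 : 0 <= g < 1.
Implicit Types (f W : T -> R) (nu : dist R T).

Definition kernel_mean f x : R := \sum_y K x y * f y.

Lemma kernel_mean_lin a b f W : kernel_mean (fun x => a * f x + b * W x) =
  fun x => a * kernel_mean f x + b * kernel_mean W x.
Proof.
apply/funext => x; rewrite /kernel_mean !mulr_sumr -big_split/=.
by apply: eq_bigr => y _; ring.
Qed.

Lemma kernel_mean_abs c W x : (forall y, `|W y| <= c) -> `|kernel_mean W x| <= c.
Proof.
move=> Wc; apply: le_trans (ler_norm_sum _ _ _) _.
rewrite -[leRHS]mul1r -(dist_sum1 (K x)) mulr_suml; apply: ler_sum => y _.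
by rewrite normrM ger0_norm ?dist_ge0// ler_wpM2l ?dist_ge0.
Qed.

(* A minimum m of W satisfies m >= g * m. *)
Lemma superharmonic_ge0 W : (forall x, g * kernel_mean W x <= W x) ->
  forall x, 0 <= W x.
Proof.
move=> gW x; case: (@arg_minP _ _ _ x xpredT W isT) => m _ mmin.
apply: le_trans (mmin x isT).
have /andP[g0 g1] := g01.
have : g * W m <= W m.
  apply: le_trans (gW m); apply: ler_wpM2l => //.
  rewrite -[leLHS]mul1r -(dist_sum1 (K m)) mulr_suml; apply: ler_sum => y _.
  by rewrite ler_wpM2l ?dist_ge0// mmin.
by move=> h; have : 0 <= (1 - g) * W m by [lra]; rewrite pmulr_rge0// subr_gt0.
Qed.

(** The difference of two solutions solves the equation with f = 0, so [superharmonic_ge0] applies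
    to it and to its negative. *)
Lemma fixpoint_uniq f W1 W2 : (forall x, W1 x = f x + g * kernel_mean W1 x) ->
  (forall x, W2 x = f x + g * kernel_mean W2 x) -> W1 =1 W2.
Proof.
move=> E1 E2 x; apply/eqP; rewrite eq_le.
have E a b y : g * kernel_mean (fun y => a * W1 y + b * W2 y) y =
    a * (W1 y - f y) + b * (W2 y - f y).
  by rewrite kernel_mean_lin (E1 y) (E2 y); ring.
have h1 : 0 <= (-1) * W1 x + 1 * W2 x.
  apply: (@superharmonic_ge0 (fun y => (-1) * W1 y + 1 * W2 y)) => y.
  by rewrite E; lra.
have h2 : 0 <= 1 * W1 x + (-1) * W2 x.
  apply: (@superharmonic_ge0 (fun y => 1 * W1 y + (-1) * W2 y)) => y.
  by rewrite E; lra.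
by apply/andP; split; lra.
Qed.

(** In finite dimension 1 - g K is invertible once it is injective, and injectivity is
    [fixpoint_uniq] at f = 0. The sigma type lets [visitation_mean] select one solution per
    state. *)
Lemma fixpoint_exists f : {W | forall x, W x = f x + g * kernel_mean W x}.
Proof.
(* The matrix is the transpose of 1 - g K because functions are encoded as row vectors. *)
pose A : 'M[R]_#|T| := \matrix_(i, j)
  ((i == j)%:R - g * K (enum_val j) (enum_val i)).
have AE (v : 'rV_#|T|) x : (v *m A) 0 (enum_rank x) =
    v 0 (enum_rank x) - g * kernel_mean (fun y => v 0 (enum_rank y)) x.
  rewrite mxE.
  transitivity (\sum_i (v 0 i * (i == enum_rank x)%:R -
                  g * (K x (enum_val i) * v 0 i))).
    by apply: eq_bigr => i _; rewrite mxE enum_rankK; ring.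
  rewrite sumrB -mulr_sumr; congr (_ - g * _).
    rewrite (bigD1 (enum_rank x))//= eqxx mulr1 big1 ?addr0// => i /negPf ->.
    by rewrite mulr0.
  rewrite /kernel_mean (big_enum_val (fun y => K x y * v 0 (enum_rank y))).
  by apply: eq_bigr => i _; rewrite enum_valK.
have Au : A \in unitmx.
  rewrite -row_free_unit; apply/inj_row_free => v vA0.
  apply/rowP => i; rewrite -[i]enum_valK mxE.
  have := @fixpoint_uniq (fun=> 0) (fun x => v 0 (enum_rank x)) (fun=> 0).
  apply=> x.
    by have := AE v x; rewrite vA0 mxE => /eqP; rewrite eq_sym subr_eq0 add0r => /eqP.
  by rewrite /kernel_mean big1 ?mulr0 ?addr0// => y _; rewrite mulr0.
pose w := (\row_i f (enum_val i)) *m invmx A.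
exists (fun x => w 0 (enum_rank x)) => x.
by have := AE w x; rewrite mulmxKV// mxE enum_rankK => ->; rewrite subrK.
Qed.

Lemma iter_kernel_mean_lin n a b f W :
  iter n kernel_mean (fun x => a * f x + b * W x) =
  fun x => a * iter n kernel_mean f x + b * iter n kernel_mean W x.
Proof. by elim: n => //= n ->; rewrite kernel_mean_lin. Qed.

Lemma iter_kernel_mean_abs n c W x :
  (forall y, `|W y| <= c) -> `|iter n kernel_mean W x| <= c.
Proof.
by elim: n x => [//|n IH] x Wc /=; apply: kernel_mean_abs => y; exact: IH.
Qed.

(* Iterating W = f + g K W gives partial sums of the discounted series, with
   remainder g^n K^n W. *)
Lemma expected_discounted_sum_fixpoint nu f W : (forall x, 0 <= f x) ->
  (forall x, W x = f x + g * kernel_mean W x) ->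
  expected_discounted_sum nu K g f = \sum_x nu x * W x.
Proof.
move=> f0 WE; have /andP[g0 g1] := g01.
pose u t : R := \sum_x nu x * (g ^+ t * iter t kernel_mean f x).
have [mX _] := chainP nu K.
have uE t : (\int[unif R]_w (g ^+ t * f (chain nu K t w))%:E = (u t)%:E)%E.
  have gf0 x : 0 <= g ^+ t * f x by rewrite mulr_ge0 ?exprn_ge0.
  rewrite (@markov_chain_fun _ _ _ _ _ _ _ _ (fun x => g ^+ t * f x) t (chainP nu K))//.
  congr _%:E; apply: eq_bigr => x _; congr (_ * _).
  have := congr1 (fun k => k x) (iter_kernel_mean_lin t (g ^+ t) 0 f f).
  rewrite mul0r addr0 => <-; congr (iter _ _ _ x).
  by apply/funext => y; rewrite mul0r addr0.
rewrite /expected_discounted_sum integral_nneseries//; last 2 first.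
- move=> t.
  by apply: (measurable_fun_fin_valued (fun x => (g ^+ t * f x)%:E)) => x; exact: mX.
- by move=> t w _; rewrite lee_fin mulr_ge0 ?exprn_ge0.
under eq_eseriesr do rewrite uE.
suff ucvg : (series u @ \oo --> \sum_x nu x * W x)%classic.
  rewrite (_ : (fun n => _) = EFin \o series u).
    by rewrite EFin_lim /=; [exact: cvg_lim|apply/cvg_ex; eexists; exact: ucvg].
  by apply/funext => n; rewrite /= sumEFin.
have uEl n : u n = g ^+ n * \sum_x nu x * iter n kernel_mean f x.
  by rewrite mulr_sumr; apply: eq_bigr => x _; rewrite mulrCA.
have iterW n : iter n kernel_mean W =
    fun x => 1 * iter n kernel_mean f x + g * iter n.+1 kernel_mean W x.
  rewrite iterSr -iter_kernel_mean_lin; congr (iter _ _ _).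
  by apply/funext => y; rewrite mul1r -WE.
have part n : series u n = \sum_x nu x * W x -
    g ^+ n * \sum_x nu x * iter n kernel_mean W x.
  elim: n => [|n IH]; first by rewrite /series/= big_geq// mul1r subrr.
  rewrite seriesSr IH uEl iterW.
  have -> : \sum_x nu x * (1 * iter n kernel_mean f x +
        g * iter n.+1 kernel_mean W x) =
      \sum_x nu x * iter n kernel_mean f x +
      g * \sum_x nu x * iter n.+1 kernel_mean W x.
    by rewrite mulr_sumr -big_split; apply: eq_bigr => x _ /=; ring.
  by rewrite exprSr; ring.
have [c Wc] : exists c, forall x, `|W x| <= c.
  by exists (\big[Num.max/0]_x `|W x|) => x; exact: le_bigmax.
(* Means under [nu] and [K] preserve the bound c on [W], so the remainder is at most c g^n. *)
have rc n : `|g ^+ n * \sum_x nu x * iter n kernel_mean W x| <= geometric c g n.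
  rewrite normrM ger0_norm ?exprn_ge0//= mulrC ler_wpM2r ?exprn_ge0//.
  apply: le_trans (ler_norm_sum _ _ _) _.
  rewrite -[leRHS]mul1r -(dist_sum1 nu) mulr_suml; apply: ler_sum => y _.
  by rewrite normrM ger0_norm ?dist_ge0// ler_wpM2l ?dist_ge0 ?iter_kernel_mean_abs.
rewrite (_ : series u = fun n => \sum_x nu x * W x -
    g ^+ n * \sum_x nu x * iter n kernel_mean W x); last exact/funext.
rewrite -[X in (_ --> X)%classic]subr0; apply: cvgB; first exact: cvg_cst.
have gc : (geometric c g @ \oo --> 0)%classic.
  by apply: cvg_geometric; rewrite ger0_norm.
apply: (@squeeze_cvgr _ _ _ _ (fun n => - geometric c g n) (geometric c g)) => //.
  by apply: nearW => n; rewrite -ler_norml.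
by rewrite -oppr0; exact: cvgN.
Qed.

(** The left-hand side is the term t = 0 of the series; in terms of the fixed point, [W] exceeds [f]
    by the nonnegative g K W. *)
Lemma expected_discounted_sum_ge nu f : (forall x, 0 <= f x) ->
  \sum_x nu x * f x <= expected_discounted_sum nu K g f.
Proof.
move=> f0; have [W WE] := fixpoint_exists f.
have W0 : forall x, 0 <= W x.
  by apply: superharmonic_ge0 => x; rewrite [leRHS]WE lerDr.
rewrite (expected_discounted_sum_fixpoint nu f0 WE); apply: ler_sum => x _.
rewrite ler_wpM2l ?dist_ge0// WE lerDl mulr_ge0//; first by case/andP: g01.
by apply: sumr_ge0 => y _; rewrite mulr_ge0 ?dist_ge0.
Qed.

End Resolvent.

(** * Values, visitation measures and the performance difference *)

Lemma dist_dirac_mean (R : realType) (T : finType) (x : T) (h : T -> R) :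
  \sum_y dist_dirac R x y * h y = h x.
Proof.
rewrite (bigD1 x)//= eqxx mul1r big1 ?addr0// => y /negPf ->.
by rewrite mul0r.
Qed.

Lemma dist_pair_mean (R : realType) (T U : finType) (p : dist R T)
    (k : T -> dist R U) (h : T * U -> R) :
  \sum_z dist_pair p k z * h z = \sum_t p t * \sum_u k t u * h (t, u).
Proof.
under [RHS]eq_bigr => t _ do rewrite mulr_sumr.
rewrite pair_big/=; apply: eq_bigr => -[t u] _ /=; ring.
Qed.

Lemma dist_mean_cst (R : realType) (T : finType) (p : dist R T) (c : R) :
  \sum_t p t * c = c.
Proof. by rewrite -mulr_suml dist_sum1 mul1r. Qed.

Section Values.
Variables (R : realType) (S A : finType) (M : mdp R S A).
Implicit Types (pi : policy R S A) (rho : dist R S).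

Local Notation gamma := (discount M).
Let g01 := discount_itv M.

Let step pi (H : S -> R) s :=
  \sum_a pi s a * \sum_s' transition M s a s' * H s'.

Lemma subr_discount_gt0 : 0 < 1 - gamma.
Proof. by rewrite subr_gt0; case/andP: g01. Qed.

Lemma state_action_kernel_mean pi (h : S * A -> R) z :
  kernel_mean (state_action_kernel M pi) h z =
  \sum_s transition M z.1 z.2 s * \sum_a pi s a * h (s, a).
Proof. exact: dist_pair_mean. Qed.

Lemma reward_ge0 (z : S * A) : 0 <= reward M z.1 z.2.
Proof. by case/andP: (reward_itv M z.1 z.2). Qed.

(** A single fixed point over state-action pairs represents both functions: its values are Q, and
    its mean over actions is V. *)
Lemma Vfun_Qfun pi s : Vfun M pi s = \sum_a pi s a * Qfun M pi s a.
Proof.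
have [W WE] := fixpoint_exists (state_action_kernel M pi) g01
  (fun z => reward M z.1 z.2).
rewrite /Vfun (expected_discounted_sum_fixpoint g01 _ reward_ge0 WE).
rewrite dist_pair_mean dist_dirac_mean; apply: eq_bigr => a _; congr (_ * _).
by rewrite /Qfun (expected_discounted_sum_fixpoint g01 _ reward_ge0 WE)
  dist_dirac_mean.
Qed.

Lemma Qfun_bellman pi s a : Qfun M pi s a =
  reward M s a + gamma * \sum_s' transition M s a s' * Vfun M pi s'.
Proof.
have [W WE] := fixpoint_exists (state_action_kernel M pi) g01
  (fun z => reward M z.1 z.2).
have QE s' a' : Qfun M pi s' a' = W (s', a').
  by rewrite /Qfun (expected_discounted_sum_fixpoint g01 _ reward_ge0 WE)
    dist_dirac_mean.
rewrite QE WE state_action_kernel_mean/=; congr (_ + _ * _).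
apply: eq_bigr => s' _; rewrite Vfun_Qfun; congr (_ * _).
by apply: eq_bigr => a' _; rewrite QE.
Qed.

Lemma Vfun_ge0 pi s : 0 <= Vfun M pi s.
Proof.
apply: le_trans (expected_discounted_sum_ge _ g01 _ reward_ge0).
by apply: sumr_ge0 => z _; rewrite mulr_ge0 ?dist_ge0 ?reward_ge0.
Qed.

(** The constant 1 / (1 - gamma) solves c = 1 + gamma c, so rewards at most 1 make c - Q satisfy the
    hypothesis of [superharmonic_ge0]. *)
Lemma Vfun_le pi s : Vfun M pi s <= (1 - gamma)^-1.
Proof.
have d0 := subr_discount_gt0.
have Q1 : forall z, 0 <= (1 - gamma)^-1 - Qfun M pi z.1 z.2.
  pose W z := (1 - gamma)^-1 - Qfun M pi z.1 z.2.
  apply: (superharmonic_ge0 (K := state_action_kernel M pi) g01 (W := W)) => z.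
  rewrite state_action_kernel_mean /W/=.
  under eq_bigr => s' _.
    under eq_bigr => a _ do rewrite mulrBr.
    rewrite sumrB dist_mean_cst -Vfun_Qfun mulrBr.
    over.
  rewrite sumrB dist_mean_cst Qfun_bellman.
  have /andP[_ r1] := reward_itv M z.1 z.2.
  have E : (1 - gamma)^-1 - gamma * (1 - gamma)^-1 = 1.
    by rewrite -[X in X - _]mul1r -mulrBl divff// gt_eqF.
  lra.
rewrite Vfun_Qfun -[leRHS](dist_mean_cst (pi s)); apply: ler_sum => a _.
by rewrite ler_wpM2l ?dist_ge0// -subr_ge0 (Q1 (s, a)).
Qed.

Let indic_ge0 s (z : S * A) : 0 <= (z.1 == s)%:R :> R.
Proof. exact: ler0n. Qed.

Lemma visitation_ge pi rho s : (1 - gamma) * rho s <= visitation M pi rho s.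
Proof.
rewrite ler_pM2l ?subr_discount_gt0//.
apply: le_trans (expected_discounted_sum_ge _ g01 _ (indic_ge0 s)).
rewrite (dist_pair_mean _ _ (fun z : S * A => (z.1 == s)%:R))/=.
rewrite (bigD1 s)//= eqxx dist_mean_cst mulr1 lerDl.
by apply: sumr_ge0 => t _; rewrite dist_mean_cst mulr_ge0 ?dist_ge0.
Qed.

Lemma visitation_ge0 pi rho s : 0 <= visitation M pi rho s.
Proof.
by apply: le_trans (visitation_ge _ _ _); rewrite mulr_ge0 ?dist_ge0// ltW
  ?subr_discount_gt0.
Qed.

(** [H] is the resolvent of [pi] applied to [h], and the visitation measure is 1 - gamma times the
    adjoint resolvent applied to [rho]. Combining the solutions [W s] for indicators covers [h] of
    any sign, whereas [expected_discounted_sum_fixpoint] asks for a nonnegative function. *)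
Lemma visitation_mean pi rho (h H : S -> R) :
  (forall s, H s = h s + gamma * step pi H s) ->
  \sum_s visitation M pi rho s * h s = (1 - gamma) * \sum_s rho s * H s.
Proof.
move=> HE; pose K := state_action_kernel M pi.
pose W s := sval (fixpoint_exists K g01 (fun z => (z.1 == s)%:R)).
have WE s z : W s z = (z.1 == s)%:R + gamma * kernel_mean K (W s) z.
  by rewrite /W; case: fixpoint_exists.
(* [H'] lifts [H] to state-action pairs: averaging it over the action gives [H] back, which makes it
   a fixed point for [K]. *)
pose H' z := h z.1 + gamma * \sum_s transition M z.1 z.2 s * H s.
have H'mean s : \sum_a pi s a * H' (s, a) = H s.
  under eq_bigr => a _ do rewrite /H'/= mulrDr mulrCA.
  by rewrite big_split/= dist_mean_cst -mulr_sumr HE.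
have WH' : (fun z => \sum_s W s z * h s) =1 H'.
  apply: (fixpoint_uniq (K := K) g01 (f := fun z => h z.1)) => z; last first.
    rewrite {1}/H' state_action_kernel_mean; congr (_ + _ * _).
    by apply: eq_bigr => s _; rewrite H'mean.
  under eq_bigr => s _ do rewrite WE mulrDl.
  rewrite big_split/=; congr (_ + _).
    rewrite (bigD1 z.1)//= eqxx mul1r big1 ?addr0// => s.
    by rewrite eq_sym => /negPf ->; rewrite mul0r.
  under eq_bigr => s _ do rewrite -mulrA mulr_suml.
  rewrite -mulr_sumr exchange_big/=; congr (_ * _); apply: eq_bigr => y _.
  by rewrite mulr_sumr; apply: eq_bigr => s _; rewrite mulrA.
have visE s : visitation M pi rho s =
    (1 - gamma) * \sum_z dist_pair rho pi z * W s z.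
  by rewrite /visitation (expected_discounted_sum_fixpoint g01 _ (indic_ge0 s) (WE s)).
under eq_bigr => s _ do rewrite visE -mulrA mulr_suml.
rewrite -mulr_sumr exchange_big/=; congr (_ * _).
transitivity (\sum_z dist_pair rho pi z * H' z).
  apply: eq_bigr => z _; rewrite -WH' mulr_sumr.
  by apply: eq_bigr => s _; rewrite mulrA.
by rewrite dist_pair_mean; apply: eq_bigr => s _; rewrite H'mean.
Qed.

Lemma visitation_sum1 pi rho : \sum_s visitation M pi rho s = 1.
Proof.
have d0 := subr_discount_gt0.
have := @visitation_mean pi rho (fun=> 1) (fun=> (1 - gamma)^-1).
rewrite dist_mean_cst mulfV ?gt_eqF//.
under eq_bigr do rewrite mulr1.
apply=> s; rewrite /step.
under eq_bigr do rewrite dist_mean_cst.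
rewrite dist_mean_cst; field; lra.
Qed.

(** The second sum is [Vfun M pi s], so this is the mean under [pi'] of the usual advantage of [pi].
    It is G(q) of the overview, with p = [pi s] and q = [pi' s]. *)
Definition advantage pi' pi s : R :=
  \sum_a pi' s a * Qfun M pi s a - \sum_a pi s a * Qfun M pi s a.

(** The difference of the two value functions solves the resolvent equation of [pi'] with source
    [advantage pi' pi], so [visitation_mean] applies. *)
Lemma performance_difference pi' pi rho :
  (1 - gamma) * (mean_value (Vfun M pi') rho - mean_value (Vfun M pi) rho) =
  \sum_s visitation M pi' rho s * advantage pi' pi s.
Proof.
rewrite (@visitation_mean _ _ _ (fun s => Vfun M pi' s - Vfun M pi s)).
  by congr (_ * _); rewrite -sumrB; apply: eq_bigr => s _; rewrite mulrBr.
move=> s; rewrite /advantage -Vfun_Qfun addrAC; congr (_ - _).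
rewrite Vfun_Qfun /step mulr_sumr -big_split/=; apply: eq_bigr => a _.
rewrite mulrCA -mulrDr !Qfun_bellman; congr (_ * _).
by rewrite -addrA -mulrDr -big_split/=; congr (_ + _ * _); apply: eq_bigr => s' _; ring.
Qed.

End Values.

(** * Euclidean projection onto the simplex *)

Section Projection.
Variables (R : realType) (T : finType).
Implicit Types (p q : dist R T).

Lemma dist_le1 p t : p t <= 1.
Proof.
rewrite -(dist_sum1 p) (bigD1 t)//= lerDl.
by apply: sumr_ge0 => u _; exact: dist_ge0.
Qed.

(** For x and y in [0, 1], (x - y)^2 <= x + y. *)
Lemma dist_sqr_diff_le2 p q : \sum_t (p t - q t) ^+ 2 <= 2.
Proof.
have -> : 2 = \sum_t (p t + q t) :> R by rewrite big_split/= !dist_sum1.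
apply: ler_sum => t _.
have := dist_ge0 p t; have := dist_ge0 q t.
have := dist_le1 p t; have := dist_le1 q t; nra.
Qed.

Lemma dist_mix_ge0 (e : R) p q : 0 <= e <= 1 ->
  forall t, 0 <= (1 - e) * p t + e * q t.
Proof.
by move=> /andP[e0 e1] t; rewrite addr_ge0// mulr_ge0 ?dist_ge0// subr_ge0.
Qed.

Lemma dist_mix_sum1 (e : R) p q : \sum_t ((1 - e) * p t + e * q t) = 1.
Proof. by rewrite big_split/= -!mulr_sumr !dist_sum1; ring. Qed.

(** This is first-order optimality along the segment from [p] to [q]: at (1 - e) p + e q the squared
    distance to [v] changes by 2 e B + e^2 C. *)
Lemma simplex_proj_variational v p q : is_simplex_proj v p ->
  0 <= \sum_t (p t - v t) * (q t - p t).
Proof.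
move=> projp; rewrite leNgt; apply/negP.
set B := \sum_t _ => B0; pose C := \sum_t (q t - p t) ^+ 2.
have C0 : 0 <= C by apply: sumr_ge0 => t _; exact: sqr_ge0.
have CB : 0 < C - B by lra.
(* This step length lies in (0, 1] and satisfies e C = e B - B, so 2 B + e C = B + e B < 0. *)
pose e := - B / (C - B).
have e0 : 0 < e by rewrite divr_gt0// oppr_gt0.
have eE : e * (C - B) = - B by rewrite mulfVK// gt_eqF.
have e1 : e <= 1 by rewrite ler_pdivrMr//; lra.
have e01 : 0 <= e <= 1 by rewrite (ltW e0) e1.
have := projp (Dist (dist_mix_ge0 p q e01) (dist_mix_sum1 e p q)).
rewrite ler_sqrt; last by apply: sumr_ge0 => t _; exact: sqr_ge0.
rewrite /=.
have -> : \sum_t ((1 - e) * p t + e * q t - v t) ^+ 2 =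
    \sum_t (p t - v t) ^+ 2 + (2 * e * B + e ^+ 2 * C).
  by rewrite !mulr_sumr -!big_split/=; apply: eq_bigr => t _; ring.
rewrite lerDl => h.
have : 0 <= e * (2 * B + e * C) by rewrite (_ : _ * _ = 2 * e * B + e ^+ 2 * C)//; ring.
rewrite pmulr_rge0// => h'.
have : e * B < 0 by rewrite pmulr_rlt0.
lra.
Qed.

(** This is the variational inequality tested at the starting point [p]. *)
Lemma simplex_proj_ascent (Q : T -> R) p p' (eta : R) :
  is_simplex_proj (fun t => p t + eta * Q t) p' ->
  \sum_t (p' t - p t) ^+ 2 <=
    eta * (\sum_t p' t * Q t - \sum_t p t * Q t).
Proof.
move=> /(simplex_proj_variational p) h; rewrite -subr_ge0.
move: h; congr (is_true (0 <= _)).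
rewrite -sumrB mulr_sumr -sumrB; apply: eq_bigr => t _; ring.
Qed.

(* Young's inequality bounds 2 kappa (1 - kappa) <p' - p, q - p'> by
   (1 - kappa)^2 |p' - p|^2 + kappa^2 |q - p'|^2, where |p' - p|^2 is at most
   the right-hand side and |q - p'|^2 <= 2. *)
Lemma simplex_proj_compare (Q : T -> R) p p' q (eta kappa : R) :
  0 <= kappa <= 1 ->
  is_simplex_proj (fun t => p t + eta * Q t) p' ->
  (2 * kappa - kappa ^+ 2) * (eta * (\sum_t q t * Q t - \sum_t p t * Q t))
    - 7 * kappa ^+ 2 <=
  eta * (\sum_t p' t * Q t - \sum_t p t * Q t).
Proof.
move=> /andP[k0 k1] proj.
have ascent := simplex_proj_ascent proj.
set G := _ * _ in ascent *; set X := eta * _.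
pose C := \sum_t (p' t - p t) * (q t - p' t).
have XG : X - G <= C.
  have h := simplex_proj_variational q proj; rewrite -subr_ge0.
  move: h; congr (is_true (0 <= _)).
  rewrite /X /G /C -mulrBr; rewrite -!sumrB mulr_sumr -sumrB; apply: eq_bigr => t _; ring.
have U2 := dist_sqr_diff_le2 p' p.
have W2 := dist_sqr_diff_le2 q p'.
set U := \sum_t (p' t - p t) ^+ 2 in ascent U2.
set W := \sum_t (q t - p' t) ^+ 2 in W2.
have young a b : 2 * (a * b) * C <= a ^+ 2 * U + b ^+ 2 * W.
  rewrite !mulr_sumr -big_split/=; apply: ler_sum => t _.
  rewrite -subr_ge0 (_ : _ - _ = (a * (p' t - p t) - b * (q t - p' t)) ^+ 2).
    exact: sqr_ge0.
  ring.
(* The coefficient splits as 2 kappa - kappa^2 = 2 (1 - kappa) kappa + kappa^2. Adding [y1] and half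
   of [y2] leaves an error of at most 4 kappa^2, within 7 kappa^2; the constant 7 is 2 + 5|A| at |A|
   = 1. *)
have y1 := young (1 - kappa) kappa.
have y2 := young kappa kappa.
have c0 : 0 <= 2 * kappa - kappa ^+ 2 by nra.
have := ler_wpM2l c0 XG.
have k2 := sqr_ge0 kappa; have k3 := sqr_ge0 (1 - kappa).
have := ler_wpM2l k3 ascent; have := ler_wpM2l k2 W2; have := ler_wpM2l k2 U2.
lra.
Qed.

End Projection.

(** * Density ratios and the recursion for the optimality gap *)

Lemma min_entry_le (R : realType) (T : finType) (p : dist R T) t :
  min_entry p <= p t.
Proof. exact: bigmin_le. Qed.

Lemma dist_card_gt0 (R : realType) (T : finType) (p : dist R T) : (0 < #|T|)%N.
Proof.
rewrite lt0n; apply/eqP => /card0_eq T0.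
by have /eqP := dist_sum1 p; rewrite big_pred0// eq_sym oner_eq0.
Qed.

Lemma linf_norm_ratio_ge (R : realType) (T : finType) (d : T -> R)
    (rho : dist R T) t : 0 < min_entry rho ->
  d t <= linf_norm (fun t => d t / rho t) * rho t.
Proof.
move=> rho_gt0; have rt := lt_le_trans rho_gt0 (min_entry_le rho t).
rewrite -ler_pdivrMr//; apply: le_trans (ler_norm _) _.
exact: (le_bigmax _ (fun t => `|d t / rho t|)).
Qed.

(** The mean of d / rho under [rho] is 1, so its largest entry is at least 1. This later gives b <=
    1. *)
Lemma linf_norm_ratio_ge1 (R : realType) (T : finType) (d : T -> R)
    (rho : dist R T) : 0 < min_entry rho -> \sum_t d t = 1 ->
  1 <= linf_norm (fun t => d t / rho t).
Proof.
move=> rho_gt0 <-; rewrite -[leRHS]mulr1 -(dist_sum1 rho) mulr_sumr.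
by apply: ler_sum => t _; exact: linf_norm_ratio_ge.
Qed.

Section PPG.
Variables (R : realType) (S A : finType) (M : mdp R S A) (rho : dist R S).
Hypothesis rho_gt0 : 0 < min_entry rho.

Local Notation gamma := (discount M).

(** This is x_k of the overview; the factor 1 - gamma matches [performance_difference]. *)
Definition scaled_gap (pi_opt pi : policy R S A) : R :=
  (1 - gamma) * (mean_value (Vfun M pi_opt) rho - mean_value (Vfun M pi) rho).

Lemma ppg_progress (pi_opt pi pi' : policy R S A) (eta_s : S -> R)
    (kappa eps : R) : 0 <= kappa <= 1 ->
  (forall s, 0 < eta_s s) -> (forall s, 7 / eta_s s <= eps) ->
  (forall s, is_simplex_proj (fun a => pi s a + eta_s s * Qfun M pi s a) (pi' s)) ->
  scaled_gap pi_opt pi' <= scaled_gap pi_opt pi - (1 - gamma) *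
    (linf_norm (fun s => visitation M pi_opt rho s / rho s))^-1 *
    ((2 * kappa - kappa ^+ 2) * scaled_gap pi_opt pi - kappa ^+ 2 * eps).
Proof.
move=> k01 eta0 eta7 proj.
have d0 := subr_discount_gt0 M.
set D := linf_norm _.
have D1 : 1 <= D by apply: linf_norm_ratio_ge1; rewrite ?visitation_sum1.
have D0 : 0 < D by exact: lt_le_trans D1.
(* Improvement in every state is what permits replacing the visitation weights of [pi'] by smaller
   ones. *)
have G0 s : 0 <= advantage M pi' pi s.
  rewrite -(pmulr_rge0 _ (eta0 s)).
  apply: le_trans (simplex_proj_ascent (proj s)).
  by apply: sumr_ge0 => a _; exact: sqr_ge0.
have Gcmp s : (2 * kappa - kappa ^+ 2) * advantage M pi_opt pi s -
    kappa ^+ 2 * eps <= advantage M pi' pi s.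
  have := simplex_proj_compare (pi_opt s) k01 (proj s).
  rewrite -/(advantage M pi_opt pi s) -/(advantage M pi' pi s) => h.
  rewrite -(ler_pM2l (eta0 s)); apply: le_trans h; rewrite mulrBr mulrCA.
  rewrite lerD2l lerN2 [eta_s s * _]mulrCA [7 * _]mulrC ler_wpM2l ?sqr_ge0//.
  by rewrite mulrC -ler_pdivrMr.
have PD := performance_difference M pi' pi rho.
have PDo := performance_difference M pi_opt pi rho.
have E : scaled_gap pi_opt pi' = scaled_gap pi_opt pi -
    \sum_s visitation M pi' rho s * advantage M pi' pi s.
  by rewrite -PD /scaled_gap; ring.
rewrite E lerD2l lerN2 -mulrA /scaled_gap PDo.
set X := (X in _ * X <= _).
(* The weights of [pi'] are at least (1 - gamma) rho, which dominates (1 - gamma) / D times the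
   visitation measure of [pi_opt]. *)
apply: (@le_trans _ _ (\sum_s (1 - gamma) * rho s * advantage M pi' pi s)); last first.
  by apply: ler_sum => s _; rewrite ler_wpM2r// visitation_ge.
under eq_bigr => s _ do rewrite -mulrA.
rewrite -mulr_sumr ler_pM2l// /X mulrC ler_pdivrMr// mulr_suml.
have -> : kappa ^+ 2 * eps = \sum_s visitation M pi_opt rho s * (kappa ^+ 2 * eps).
  by rewrite -mulr_suml visitation_sum1 mul1r.
rewrite mulr_sumr -sumrB; apply: ler_sum => s _.
rewrite mulrCA -mulrBr [leRHS]mulrAC [rho s * D]mulrC.
apply: (@le_trans _ _ (visitation M pi_opt rho s * advantage M pi' pi s)).
  by apply: ler_wpM2l; [exact: visitation_ge0 | exact: Gcmp].
by apply: ler_wpM2r; [exact: G0 | exact: linf_norm_ratio_ge].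
Qed.

End PPG.

Theorem theorem3p4 (R : realType) (S A : finType) (M : mdp R S A)
  (mu rho : dist R S) (mu_gt0 : 0 < min_entry mu) (rho_gt0 : 0 < min_entry rho)
  (pi_opt : policy R S A) (pi_optP : is_optimal M pi_opt)
  (C3 : R) (C3_gt0 : 0 < C3)
  (eta : nat -> R) (pi : nat -> policy R S A) (piP : is_ppg M mu eta pi)
  (eta_ge : forall k : nat,
     (2 + 5 * #|A|%:R) / min_entry mu * ((1 - discount M) / C3)
       * (1 + (1 - discount M) / C3) ^+ k.+1 <= eta k) :
  forall k : nat,
    mean_value (Vopt M) rho - mean_value (Vfun M (pi k)) rho <=
    (1 - discount M)^-1 *
    (1 - (1 - discount M)
         * (linf_norm (fun s => visitation M pi_opt rho s / rho s))^-1
         * ((1 - discount M) / (1 - discount M + C3))) ^+ k.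
Proof.
have d0 := subr_discount_gt0 M.
have -> : Vopt M = Vfun M pi_opt by apply/funext => s; rewrite pi_optP.
set D := linf_norm _; set kappa := _ / (_ + C3).
set b := (1 - discount M) * D^-1; set theta := 1 - b * kappa.
set r := (1 - discount M) / C3 in eta_ge.
have r0 : 0 < r by rewrite divr_gt0.
(* [q] equals 1 - kappa and is the inverse of the growth factor of the step sizes. *)
pose q := (1 + r)^-1.
have q0 : 0 < q by rewrite invr_gt0; lra.
have kE : kappa = 1 - q.
  by rewrite /q /r /kappa; field; apply/andP; split; lra.
have q1 : q <= 1 by rewrite invf_le1; lra.
have rq : r * q = 1 - q by rewrite /q; field; lra.
have k01 : 0 <= kappa <= 1 by rewrite kE; lra.
have D1 : 1 <= D by apply: linf_norm_ratio_ge1; rewrite ?visitation_sum1.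
have D0 : 0 < D by exact: lt_le_trans D1.
have b0 : 0 <= b by rewrite mulr_ge0 ?invr_ge0 ?ltW.
have b1 : b <= 1.
  have /andP[g0 _] := discount_itv M.
  by rewrite ler_pdivrMr// mul1r; lra.
have theta_q : q <= theta by rewrite /theta kE; nra.
have theta_ge0 : 0 <= theta by lra.
pose gap k := scaled_gap M rho pi_opt (pi k).
suff gap_le k : gap k <= theta ^+ k.
  by move=> k; rewrite mulrC ler_pdivlMr// mulrC; exact: gap_le.
elim: k => [|k IH].
  rewrite expr0 /gap /scaled_gap -ler_pdivlMl// mulr1 lerBlDr.
  apply: (@le_trans _ _ (1 - discount M)^-1).
    rewrite -[leRHS](dist_mean_cst rho); apply: ler_sum => s _.
    by rewrite ler_wpM2l ?dist_ge0// Vfun_le.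
  by rewrite lerDl; apply: sumr_ge0 => s _; rewrite mulr_ge0 ?dist_ge0 ?Vfun_ge0.
(* With this choice 7 / eps = 7 r (1 + r)^(k+1), a lower bound for [eta_s]: 7 <= 2 + 5|A|, and
   [min_entry mu] cancels because the visitation measure is at least (1 - gamma) mu. *)
pose eps := q ^+ k.+1 / r.
have eps0 : 0 < eps by rewrite divr_gt0 ?exprn_gt0.
pose eta_s s := eta k / (1 - discount M) * visitation M (pi k) mu s.
have eta7 s : 7 / eps <= eta_s s.
  have A1 : 1 <= #|A|%:R :> R by rewrite ler1n (dist_card_gt0 (pi_opt s)).
  have -> : 7 / eps = 7 * (r * (1 + r) ^+ k.+1).
    by rewrite /eps /q invf_div exprVn invrK.
  have rk0 : 0 < r * (1 + r) ^+ k.+1 by rewrite mulr_gt0// exprn_gt0//; lra.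
  apply: (@le_trans _ _ ((2 + 5 * #|A|%:R) * (r * (1 + r) ^+ k.+1))).
    by rewrite ler_pM2r//; lra.
  have etak : (2 + 5 * #|A|%:R) * (r * (1 + r) ^+ k.+1) <= eta k * min_entry mu.
    rewrite -ler_pdivrMr//; apply: le_trans (eta_ge k).
    by rewrite le_eqVlt; apply/orP; left; apply/eqP; ring.
  have etak0 : 0 < eta k.
    rewrite -(pmulr_lgt0 _ mu_gt0); apply: lt_le_trans etak.
    by rewrite mulr_gt0//; lra.
  apply: (le_trans etak); rewrite /eta_s -mulrA ler_pM2l// mulrC ler_pdivlMr// mulrC.
  apply: le_trans (visitation_ge _ _ _ _).
  by rewrite ler_pM2l// min_entry_le.
have eta0 s : 0 < eta_s s by apply: lt_le_trans (eta7 s); rewrite divr_gt0.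
have := @ppg_progress _ _ _ M rho rho_gt0 pi_opt (pi k) (pi k.+1) eta_s kappa eps
  k01 eta0 _ (piP k).
rewrite -/(gap k) -/(gap k.+1) -/D -/b => progress.
apply: le_trans (progress _) _.
  by move=> s; rewrite ler_pdivrMr// mulrC -ler_pdivrMr.
(* Since kappa = r q, kappa eps is exactly q^(k+2). *)
have keps : kappa ^+ 2 * eps = kappa * q * q ^+ k.+1.
  rewrite /eps expr2 {2}kE -rq; move: (q ^+ k.+1) => Q.
  by field; rewrite gt_eqF.
have qk : q ^+ k.+1 <= theta ^+ k.
  rewrite exprSr; apply: (@le_trans _ _ (q ^+ k)).
    by rewrite ler_piMr// exprn_ge0// ltW.
  by rewrite lerXn2r// nnegrE ltW.
(* The coefficient of the gap must be nonnegative before the induction hypothesis can be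
   inserted. *)
have c0 : 0 <= 1 - b * (2 * kappa - kappa ^+ 2).
  case/andP: k01 => k0 k1; rewrite subr_ge0 mulr_ile1//.
    rewrite (_ : _ - _ = kappa * (2 - kappa)); last by ring.
    by rewrite mulr_ge0//; lra.
  by rewrite -subr_ge0 (_ : _ - _ = (1 - kappa) ^+ 2) ?sqr_ge0//; ring.
have h1 := ler_wpM2l c0 IH.
have bkq : 0 <= b * (kappa * q).
  by case/andP: k01 => k0 _; do 2![apply: mulr_ge0 => //]; exact: ltW.
have h2 := ler_wpM2l bkq qk.
(* The identity rests on 2 kappa - kappa^2 - kappa q = kappa. *)
have -> : theta ^+ k.+1 = (1 - b * (2 * kappa - kappa ^+ 2)) * theta ^+ k +
    b * (kappa * q) * theta ^+ k.
  by rewrite exprSr {2}/theta; move: (theta ^+ k) => t; rewrite kE; ring.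
rewrite keps; lra.
Qed.
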